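(* Let $k\ge1$. For every $n\ge0$ and $j\ge1$, \[ \alpha_{n,j}^{(k)}=\frac{1}{\binom{n+k}{k}}\sum_{s=1}^{k}(-1)^s\,k\binom{k-1}{s-1}\frac{(n+1)_{s-1}}{(n+k+1)_s}\binom{n-j+s+k}{k}\binom{j-s+k-1}{k-1}. \] Equivalently, only the indices $\max\{1,j-n\}\le s\le\min\{k,j\}$ can contribute to the sum.
   Context: $(a)_m=a(a+1)\cdots(a+m-1)$ is the rising factorial, with $(a)_0=1$. For integers $a,b$ the convention $\binom ab=0$ unless $0\le b\le a$ is used. $H^2(\mathbb D^2)$ is the Hardy space over the bidisk, in which the monomials $z^aw^b$ ($a,b\ge0$) form an orthonormal basis. For $k\ge1$ let $p_k=(z-w)^k$ and let $M_k=[p_k]$ be the closure of $p_k\mathbb C[z,w]$ in $H^2(\mathbb D^2)$. For $n\ge0$ let $A^n=\left(\langle p_kz^iw^{n-i},p_kz^jw^{n-j}\rangle\right)_{i,j=0}^n$ (a real symmetric positive definite Toeplitz matrix), let $A^n_{i,j}$ be the algebraic (signed) cofactor of its $(i,j)$ entry (indices from $0$ to $n$; $A^0_{0,0}=1$), and put $D_0=1$, $D_n=\det A^{n-1}$ for $n\ge1$. Set \[ \phi_n=\frac{\sum_{l=0}^nA^n_{0,l}\,p_kz^lw^{n-l}}{\sqrt{D_nD_{n+1}}},\qquad \psi_n=\frac{\sum_{l=0}^nA^n_{n,l}\,p_kz^lw^{n-l}}{\sqrt{D_nD_{n+1}}}\qquad(n\ge0). \] These are orthonormal bases of $M_k\ominus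 zM_k$ and $M_k\ominus wM_k$ respectively. For $n\ge0$, $j\ge1$ define $\alpha_{n,j}^{(k)}=\langle w^j\phi_n,z^j\psi_n\rangle$. *)

(* Defs.v *)
From HB Require Import structures.
From mathcomp Require Import all_boot all_order all_algebra.
From mathcomp Require Import complex.
From mathcomp Require Import boolp classical_sets reals topology normedtype sequences.

Set Implicit Arguments.
Unset Strict Implicit.
Unset Printing Implicit Defensive.

Import Order.TTheory GRing.Theory Num.Theory.
Import numFieldNormedType.Exports.

Local Open Scope ring_scope.

Definition box_sum (K : nmodType) (u : nat -> nat -> K) (N : nat) : K :=
  \sum_(a < N) \sum_(b < N) u a b.

Definition box_lim (K : numFieldType) (u : nat -> nat -> K) : K :=
  limn (box_sum u : nat -> K^o).

Definition box_cvg (K : numFieldType) (u : nat -> nat -> K) : Prop :=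
  cvgn (box_sum u : nat -> K^o).

(* An element of H^2(D^2) is given by its Taylor coefficients at 0: [f a b] is
   the coefficient of z^a w^b, and f belongs to the space when these
   coefficients are square-summable.  Then all the double series in [hdot] converge
   absolutely, so that summing along squares is harmless. *)
Record hardy2 (R : realType) := Hardy2 {
  coefH :> nat -> nat -> R[i];
  _ : box_cvg (fun a b => `|coefH a b| ^+ 2) }.

Definition hdot (R : realType) (f g : hardy2 R) : R[i] :=
  box_lim (fun a b => f a b * (g a b)^*).

(* C[z,w] is {poly {poly C}} with z the outer and w the inner variable, so that
   [p`_a`_b] is the coefficient of z^a w^b. *)
Notation bipoly R := {poly {poly R[i]}}.

Definition zvar (R : realType) : bipoly R := 'X.
Definition wvar (R : realType) : bipoly R := ('X)%:P.

Definition bdeg (R : realType) (p : bipoly R) : nat :=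
  maxn (size p) (\max_(a < size p) size (p`_a)%R).

Lemma bipoly_coef0 (R : realType) (p : bipoly R) (a b : nat) :
  (bdeg p <= maxn a b)%N -> p`_a`_b = 0.
Proof.
move=> le_p; have [sz_a|lt_a] := leqP (size p) a.
  by rewrite (nth_default _ sz_a) coef0.
apply: nth_default; move: le_p.
have le_sa : (size (p`_a)%R <= bdeg p)%N.
  rewrite leq_max; apply/orP; right.
  exact: (@leq_bigmax _ (fun i : 'I_(size p) => size (p`_i)%R) (Ordinal lt_a)).
have lt_ab : (a < bdeg p)%N by rewrite leq_max lt_a.
by rewrite leq_max leqNgt lt_ab /=; exact: leq_trans.
Qed.

Lemma box_sum_stable (K : nmodType) (u : nat -> nat -> K) (N0 N : nat) :
  (forall a b, (N0 <= maxn a b)%N -> u a b = 0) -> (N0 <= N)%N ->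
  box_sum u N = box_sum u N0.
Proof.
move=> u0; elim: N => [|N IHN]; first by rewrite leqn0 => /eqP->.
rewrite leq_eqVlt ltnS => /orP[/eqP-> //|le_N].
rewrite -IHN // /box_sum big_ord_recr /= [X in _ + X]big1 ?addr0.
  by apply: eq_bigr => a _; rewrite big_ord_recr /= u0 ?addr0 // leq_max le_N orbT.
by move=> b _; rewrite u0 // leq_max le_N.
Qed.

Lemma box_sum_near (K : numFieldType) (u : nat -> nat -> K) (N0 : nat) :
  (forall a b, (N0 <= maxn a b)%N -> u a b = 0) ->
  ((box_sum u : nat -> K^o) @ \oo --> (box_sum u N0 : K^o))%classic.
Proof.
move=> u0; apply: cvg_near_cst; exists N0 => // N /= le_N.
by rewrite (box_sum_stable u0 le_N).
Qed.

Fact bipoly_hardy (R : realType) (p : bipoly R) :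
  box_cvg (fun a b => `|p`_a`_b| ^+ 2).
Proof.
apply: cvgP; apply: (@box_sum_near _ _ (bdeg p)) => a b /bipoly_coef0->.
by rewrite normr0 expr0n.
Qed.

Definition toH2 (R : realType) (p : bipoly R) : hardy2 R :=
  Hardy2 (@bipoly_hardy R p).

Notation "<( p , q )>" := (hdot (toH2 p) (toH2 q))
  (at level 0, format "<( p ,  q )>") : ring_scope.

Lemma hdot_bipoly (R : realType) (p q : bipoly R) (N : nat) :
  (minn (bdeg p) (bdeg q) <= N)%N ->
  <(p, q)> = \sum_(a < N) \sum_(b < N) p`_a`_b * (q`_a`_b)^*.
Proof.
move=> le_N; pose u a b := p`_a`_b * (q`_a`_b)^*.
suff cvg_u : ((box_sum u : nat -> R[i]^o) @ \oo --> (box_sum u N : R[i]^o))%classic.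
  by apply: (cvg_lim _ cvg_u); exact: norm_hausdorff.
apply: box_sum_near => a b le_ab; rewrite /u.
move: (leq_trans le_N le_ab); rewrite geq_min /= => /orP[] /bipoly_coef0->.
  by rewrite mul0r.
by rewrite rmorph0 mulr0.
Qed.

Lemma hdot_monomials (R : realType) (a b c d : nat) :
  <(zvar R ^+ a * wvar R ^+ b, zvar R ^+ c * wvar R ^+ d)> =
  ((a == c) && (b == d))%:R.
Proof.
have coefE (a' b' i j : nat) :
    (zvar R ^+ a' * wvar R ^+ b')`_i`_j = ((i == a') && (j == b'))%:R :> R[i].
  rewrite /zvar /wvar -rmorphXn coefMC coefXn.
  by case: (i == a'); rewrite ?mul1r ?coefXn // mul0r coef0.
set p := _ * wvar R ^+ b; set q := _ * wvar R ^+ d.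
pose N := maxn (maxn a b).+1 (minn (bdeg p) (bdeg q)).
have lt_a : (a < N)%N by rewrite leq_max ltnS leq_maxl.
have lt_b : (b < N)%N by rewrite leq_max ltnS leq_maxr.
rewrite (@hdot_bipoly _ _ _ N) ?leq_maxr //.
rewrite (bigD1 (Ordinal lt_a)) //= (bigD1 (Ordinal lt_b)) //= !coefE !eqxx mul1r.
rewrite rmorph_nat !big1 ?addr0 // => [i ne_i|i ne_i].
  by rewrite big1 // => j _; rewrite !coefE -val_eqE /= in ne_i *;
     rewrite (negPf ne_i) mul0r.
by rewrite !coefE -val_eqE /= in ne_i *; rewrite (negPf ne_i) andbF mul0r.
Qed.

Definition pk (R : realType) (k : nat) : bipoly R := (zvar R - wvar R) ^+ k.

Definition pmon (R : realType) (k n l : nat) : bipoly R :=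
  pk R k * zvar R ^+ l * wvar R ^+ (n - l).

Definition gramA (R : realType) (k n : nat) : 'M[R[i]]_n.+1 :=
  \matrix_(i, j) <(pmon R k n i, pmon R k n j)>.

Definition detD (R : realType) (k n : nat) : R[i] :=
  if n is m.+1 then \det (gramA R k m) else 1.

(* the common shape of phi_n (r = ord0) and psi_n (r = ord_max) *)
Definition cofrow (R : realType) (k n : nat) (r : 'I_n.+1) : bipoly R :=
  (sqrtC (detD R k n * detD R k n.+1))^-1%:P%:P *
    \sum_(l < n.+1) (cofactor (gramA R k n) r l)%:P%:P * pmon R k n l.

Definition phi (R : realType) (k n : nat) : bipoly R := cofrow R k (@ord0 n).

Definition psi (R : realType) (k n : nat) : bipoly R := cofrow R k (@ord_max n).

Definition alpha (R : realType) (k n j : nat) : R[i] :=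
  <(wvar R ^+ j * phi R k n, zvar R ^+ j * psi R k n)>.

Definition rising (K : pzSemiRingType) (a : K) (m : nat) : K :=
  \prod_(i < m) (a + i%:R).

(* binomial coefficient of two integers, 0 unless 0 <= b <= a *)
Definition binz (a b : int) : nat :=
  if (0 <= b) && (b <= a) then 'C(`|a|, `|b|) else 0%N.

Definition alpha_term (R : realType) (k n j s : nat) : R[i] :=
  (-1) ^+ s * k%:R * (binz (k%:Z - 1) (s%:Z - 1))%:R
  * (rising n.+1%:R (s - 1) / rising (n + k + 1)%:R s)
  * (binz (n%:Z - j%:Z + s%:Z + k%:Z) k%:Z)%:R
  * (binz (j%:Z - s%:Z + k%:Z - 1) (k%:Z - 1))%:R.

(* Main.v *)
Require Import Defs.
From mathcomp Require Import all_boot all_order all_algebra.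
From mathcomp Require Import complex reals.
From mathcomp Require Import ring zify.
Set Implicit Arguments.
Unset Strict Implicit.
Unset Printing Implicit Defensive.
Import Order.TTheory GRing.Theory Num.Theory.

Local Open Scope ring_scope.

(** The Gram matrix is the Toeplitz matrix of the symbol |1 - t|^(2k), so its
    entries are c_(a-b) with c_m = (-1)^m C(2k, k+m).  Put
    U_l = C(l+k-1, k-1) C(n-l+k, k) and E(q) = sum_l U_l c_(l-q).  Each E(q) is
    a terminating Saalschuetz sum: E(0) = C(n+2k, k), E(q) = 0 for 1 <= q <= n
    or q > n+k, and E(n+s) = (-1)^s C(n+2k, k-s) C(n+s-1, s-1) for 1 <= s <= k.
    The first two values say that U and its reversal span the first and last
    columns of the inverse Gram matrix; Cramer's rule then gives
    D_(n+1) C(n+k, k) = C(n+2k, k) D_n and identifies the coefficients of phi_n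
    and psi_n.  Hence alpha is a multiple of sum_m U_(n-m) E(m+j), in which only
    m + j = n + s with 1 <= s <= k survives. *)

(** * Binomial convolutions and the terminating Saalschuetz sum *)

(** Coefficient of x^t in (1+x)^(-a-1) (1+x)^(a+b+1) = (1+x)^b; the induction on [a] and [t] is
    Pascal's rule on both sides. *)
Lemma alt_Vandermonde (K : comNzRingType) a b t :
  \sum_(i < t.+1) (-1) ^+ i * ('C(i + a, a) * 'C((a + b).+1, t - i))%:R
  = 'C(b, t)%:R :> K.
Proof.
elim: a b t => [|a IHa] b; elim=> [|t IHt]; rewrite big_ord_recl /=.
- by rewrite big_ord0 !bin0 mul1r addr0.
- rewrite expr0 mul1r addn0 bin0 mul1n add0n subn0.
  transitivity ('C(b.+1, t.+1)%:R - 'C(b, t)%:R : K); last first.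
    by rewrite binS natrD addrK.
  congr (_ + _); rewrite -IHt -sumrN; apply: eq_bigr => i _.
  by rewrite /bump add1n exprS mulN1r mulNr subSS !bin0.
- by rewrite big_ord0 subnn !bin0 add0n binn expr0 mul1r addr0.
- have := IHa b.+1 t.+1; rewrite big_ord_recl /= => IH.
  transitivity ('C(b.+1, t.+1)%:R - 'C(b, t)%:R : K); last first.
    by rewrite binS natrD addrK.
  rewrite -IH -IHt -addrA !add0n !binn -?addSnnS; congr (_ + _).
  rewrite -sumrN -big_split /=; apply: eq_bigr => i _.
  have -> : 'C(i.+1 + a.+1, a.+1) = ('C(i.+1 + a, a) + 'C(i + a.+1, a.+1))%N.
    by rewrite addnS binS addnC addSnnS.
  rewrite /bump add1n subSS exprS mulN1r !mulNr mulnDl natrD mulrDr opprD.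
  by [].
Qed.

(** Coefficient of x^t in (1-x)^(-a-1) (1-x)^(-m-1) = (1-x)^(-a-m-2). *)
Lemma bin_conv a m t :
  (\sum_(j < t.+1) 'C(a + j, j) * 'C(m + (t - j), t - j) = 'C((a + m + t).+1, t))%N.
Proof.
elim: a t => [|a IHa]; elim=> [|t IHt]; rewrite big_ord_recl /=.
- by rewrite big_ord0 !bin0.
- rewrite !addn0 bin0 mul1n add0n subn0 binS; congr addn.
  rewrite addnS -[m in RHS]add0n -IHt; apply: eq_bigr => i _.
  by rewrite /bump add1n subSS !add0n !binn.
- by rewrite big_ord0 !bin0.
- have := IHa t.+1; rewrite big_ord_recl /= => IH.
  have -> : 'C((a.+1 + m + t.+1).+1, t.+1)
      = ('C((a + m + t.+1).+1, t.+1) + 'C((a.+1 + m + t).+1, t))%N.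
    by rewrite !addSn binS !addnS.
  rewrite -IH -IHt -addnA !bin0; congr addn.
  rewrite -big_split /=; apply: eq_bigr => i _.
  rewrite /bump add1n subSS -mulnDl; congr muln.
  by rewrite addSn addnS binS addSn.
Qed.

(** Inclusion-exclusion over the [b]-subsets of an [m]-set that avoid a given [l]-subset. *)
Lemma bin_sub_expand (K : comNzRingType) l b m : (l <= m)%N ->
  'C(m - l, b)%:R = \sum_(j < b.+1) (-1) ^+ j * ('C(l, j) * 'C(m - j, b - j))%:R :> K.
Proof.
elim: l b m => [|l IHl] b m le_lm.
  rewrite big_ord_recl big1 /= => [|i _]; last by rewrite bin0n mul0n mulr0.
  by rewrite !subn0 expr0 mul1r bin0 mul1n addr0.
case: m le_lm => // m le_lm; rewrite subSS.
case: b => [|b]; first by rewrite big_ord1 !subn0 !bin0 mul1r.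
have -> : 'C(m - l, b.+1)%:R = 'C(m.+1 - l, b.+1)%:R - 'C(m - l, b)%:R :> K.
  by rewrite subSn // binS natrD addrK.
rewrite !IHl ?leqW // [RHS]big_ord_recl [in LHS]big_ord_recl /=.
rewrite !bin0 -addrA; congr (_ + _); rewrite -sumrN -big_split /=.
apply: eq_bigr => i _.
by rewrite /bump add1n !subSS binS mulnDl natrD mulrDr exprS mulN1r !mulNr.
Qed.

(** Both sides are the multinomial (x+y+z)! / (x! y! z!). *)
Lemma trinomial x y z :
  ('C(x + y + z, x + y) * 'C(x + y, x) = 'C(x + y + z, x) * 'C(y + z, y))%N.
Proof.
have f m m' : ('C(m + m', m) * (m`! * m'`!) = (m + m')`!)%N.
  by rewrite -(bin_fact (leq_addr m' m)) addKn.
apply/eqP; rewrite -(eqn_pmul2r (fact_gt0 x)) -(eqn_pmul2r (fact_gt0 y)).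
rewrite -(eqn_pmul2r (fact_gt0 z)); apply/eqP.
transitivity ((x + y + z)`!); first by rewrite -(f (x + y) z) -(f x y); ring.
by rewrite -addnA -(f x (y + z)) -(f y z); ring.
Qed.

(* Expanding [C(n+b-l, b)] in the [C(l, j)] reduces the Pfaff-Saalschuetz sum to
   one alternating and one ordinary Vandermonde convolution. *)
Lemma saalschutz (K : comNzRingType) a b n t : (t <= n + b)%N ->
  \sum_(l < t.+1) (-1) ^+ l *
     ('C(l + a, a) * 'C((a + b).+1, t - l) * 'C(n + b - l, b))%:R
  = (if (t <= b)%N then 'C(n + b - t, b - t) * 'C((a + b + n).+1, t) else 0)%N%:R :> K.
Proof.
move=> le_t; pose F l j : K := (-1) ^+ (l + j) *
  ('C(a + j, j) * 'C(n + b - j, b - j) * ('C(l + a, a + j) * 'C((a + b).+1, t - l)))%:R.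
transitivity (\sum_(j < b.+1) \sum_(l < t.+1) F l j).
  rewrite exchange_big; apply: eq_bigr => l _.
  have le_l : (l <= n + b)%N by apply: leq_trans le_t; rewrite -ltnS.
  rewrite !natrM (bin_sub_expand _ _ le_l) !mulr_sumr; apply: eq_bigr => j _.
  have Hjl : ('C(l + a, a) * 'C(l, j) = 'C(a + j, j) * 'C(l + a, a + j))%N.
    have [lt_lj|/subnKC <-] := ltnP l j.
      by rewrite (bin_small lt_lj) (@bin_small (l + a) (a + j)) ?muln0 //; lia.
    rewrite (_ : j + (l - j) + a = a + j + (l - j))%N; last by ring.
    rewrite -trinomial mulnC; congr muln.
    by rewrite -[RHS]bin_sub ?leq_addl // addnK.
  rewrite -natrM [X in _ * X]mulrCA -natrM mulrA -exprD; congr (_ * _%:R).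
  by rewrite mulnACA Hjl; ring.
(* Terms with l < j vanish; shifting [l] by [j] leaves [alt_Vandermonde] with parameters a + j and b
   - j, and the two signs (-1)^j cancel. *)
have inner (j : 'I_b.+1) : \sum_(l < t.+1) F l j = (if (j <= t)%N then
    'C(a + j, j) * 'C(n + b - j, b - j) * 'C(b - j, t - j) else 0)%N%:R.
  have le_jb : (j <= b)%N by rewrite -ltnS.
  have [le_jt|lt_tj] := leqP; last first.
    rewrite big1 // => l _; rewrite /F (@bin_small (l + a)) ?mul0n ?muln0 ?mulr0 //.
    by have := ltn_ord l; lia.
  rewrite -(big_mkord xpredT (fun l => F l j)) (big_cat_nat (n := j)) ?leqW //=.
  rewrite big_nat big1 ?add0r => [|l /andP[_ lt_lj]]; last first.
    by rewrite /F (@bin_small (l + a)) ?mul0n ?muln0 ?mulr0 //; lia.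
  rewrite -{1}[j : nat]add0n big_addn subSn // big_mkord.
  rewrite natrM -(alt_Vandermonde _ (a + j)) mulr_sumr; apply: eq_bigr => l _.
  rewrite /F -[(a + j + (b - j))%N]addnA subnKC // -subnDA [(j + l)%N]addnC.
  rewrite (addnAC l j a) -(addnA l a j) -(addnA l j j) exprD addnn -mul2n exprM.
  by rewrite sqrrN !expr1n mulr1 mulrCA -natrM.
rewrite (eq_bigr _ (fun j _ => inner j)) -natr_sum; congr _%:R.
have [le_tb|lt_bt] := leqP t b; last first.
  by rewrite big1 // => j _; case: ifP => // _; rewrite (@bin_small (b - j)) ?muln0 //;
     have := ltn_ord j; lia.
pose G j := (if (j <= t)%N then
    'C(a + j, j) * 'C(n + b - j, b - j) * 'C(b - j, t - j) else 0)%N.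
rewrite -(big_mkord xpredT G) (big_cat_nat (n := t.+1)) ?ltnS //=.
rewrite [X in (_ + X)%N]big_nat [X in (_ + X)%N]big1 ?addn0 => [|j /andP[lt_tj _]].
  rewrite big_mkord.
  have -> : ((a + b + n).+1 = (a + (n + b - t) + t).+1)%N by lia.
  rewrite -bin_conv big_distrr; apply: eq_bigr => j _ /=.
  have le_jt : (j <= t)%N by rewrite -ltnS.
  (* [trinomial] pulls out C(n+b-t, b-t), which does not depend on [j]; what remains is [bin_conv]
     with m = n + b - t. *)
  rewrite /G le_jt; have := trinomial (t - j) (b - t) n.
  have -> : (t - j + (b - t) = b - j)%N by lia.
  have -> : (b - j + n = n + b - j)%N by lia.
  have -> : (b - t + n = n + b - t)%N by lia.
  have -> : (n + b - t + (t - j) = n + b - j)%N by lia.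
  by rewrite -mulnA => ->; ring.
by rewrite /G leqNgt lt_tj.
Qed.

(** * Sums of U_l against the Toeplitz entries *)

Lemma sum_ord_widen (V : nmodType) (F : nat -> V) m p : (m <= p)%N ->
  (forall l, (m <= l < p)%N -> F l = 0) -> \sum_(l < m) F l = \sum_(l < p) F l.
Proof.
move=> le_mp F0; rewrite -!(big_mkord xpredT F) [RHS](big_cat_nat (n := m)) //=.
by rewrite [X in _ = _ + X]big_nat [X in _ = _ + X]big1 ?addr0.
Qed.

(* [toep K k a c] is c_(a-c); the test only guards the truncated subtraction. *)
Definition toep (K : comNzRingType) (k a c : nat) : K :=
  if (a <= k + c)%N then (-1) ^+ (a + c) * 'C(k.*2, k + c - a)%:R else 0.

Definition ucoef (k n l : nat) : nat := 'C(l + k.-1, k.-1) * 'C(n - l + k, k).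

Lemma toep_sum_low (K : comNzRingType) k n q : (0 < k)%N -> (q <= n)%N ->
  \sum_(l < n.+1) (ucoef k n l)%:R * toep K k l q = ('C(n + k.*2, k) * (q == 0%N))%:R.
Proof.
case: k => // k _ le_qn.
(* With [k.+1] as the exponent, c_(l-q) is a sign times C(2(k+1), t-l). This is [saalschutz] at (k,
   k+1), whose value vanishes for t > k+1, that is for q > 0. *)
pose t := (k.+1 + q)%N; have le_t : (t <= n + k.+1)%N by rewrite /t; lia.
pose F l : K := if (l <= t)%N then (-1) ^+ q * ((-1) ^+ l *
     ('C(l + k, k) * 'C((k + k.+1).+1, t - l) * 'C(n + k.+1 - l, k.+1))%:R) else 0.
transitivity (\sum_(l < n.+1) F l).
  apply: eq_bigr => l _; rewrite /toep /F -/t; case: ifP => _; last by rewrite mulr0.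
  have le_ln : (l <= n)%N by rewrite -ltnS.
  have -> : ((k + k.+1).+1 = k.+1.*2)%N by lia.
  rewrite /ucoef addnBAC // exprD !natrM /=; ring.
(* The bounds [n] and [t] are not comparable: widen to n + k + 1, where C(n+k+1-l, k+1) kills the
   new terms, then cut down to [t], where the test in [F] does. *)
rewrite (@sum_ord_widen _ F _ (n + k.+1).+1); first last.
- by move=> l ?; rewrite /F (@bin_small (n + k.+1 - l)); [rewrite !(muln0, mulr0) if_same|lia].
- lia.
rewrite -(@sum_ord_widen _ F t.+1); first last.
- by move=> l ?; rewrite /F leqNgt; case: ifP => //; lia.
- lia.
transitivity ((-1) ^+ q * \sum_(l < t.+1) ((-1) ^+ l *
     ('C(l + k, k) * 'C((k + k.+1).+1, t - l) * 'C(n + k.+1 - l, k.+1))%:R) : K).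
  by rewrite mulr_sumr; apply: eq_bigr => l _; rewrite /F -ltnS ltn_ord.
rewrite saalschutz //; case: q @t le_t {F le_qn} => [|q] t le_t; last first.
  by rewrite ifN ?mulr0 ?muln0 // /t; lia.
rewrite /t addn0 leqnn subnn addnK !bin0 mul1r mul1n muln1.
by congr ('C(_, _)%:R); lia.
Qed.

(* Reversing [l] turns the sum into the Saalschuetz sum of [toep_sum_low] with the
   roles of [k-1] and [k] exchanged. *)
Lemma toep_sum_high (K : comNzRingType) k n s : (0 < k)%N -> (0 < s)%N ->
  \sum_(l < n.+1) (ucoef k n l)%:R * toep K k l (n + s) =
  if (s <= k)%N then (-1) ^+ s * ('C(n + k.*2, k - s) * 'C((n + s).-1, s.-1))%:R else 0.
Proof.
case: k => // k _; case: s => // s _.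
pose F l : K := if (s.+1 + l <= k.+1)%N then (-1) ^+ s.+1 * ((-1) ^+ l *
     ('C(l + k.+1, k.+1) * 'C((k.+1 + k).+1, k - s - l) * 'C(n + k - l, k))%:R) else 0.
transitivity (\sum_(l < n.+1) F l).
  rewrite (reindex_inj rev_ord_inj); apply: eq_bigr => l _ /=; rewrite subSS.
  have le_ln : (l <= n)%N by rewrite -ltnS.
  rewrite /toep /F ifT; last lia.
  rewrite /ucoef subKn //= (addnBAC k le_ln).
  have -> : (k.+1 + (n + s.+1) - (n - l) = k.+1 + s.+1 + l)%N by lia.
  have [le_sl|lt_sl] := leqP (s.+1 + l) k.+1; last first.
    by rewrite (@bin_small (k.+1.*2)) ?mulr0 //; lia.
  have -> : ((k.+1 + k).+1 = k.+1.*2)%N by lia.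
  rewrite -(@bin_sub k.+1.*2); last lia.
  have -> : (k.+1.*2 - (k.+1 + s.+1 + l) = k - s - l)%N by lia.
  have -> : (-1) ^+ (n - l + (n + s.+1)) = (-1) ^+ s.+1 * (-1) ^+ l :> K.
    rewrite -exprD -signr_odd -[RHS]signr_odd; congr (_ ^+ nat_of_bool _).
    by rewrite !oddD oddB //; case: (odd n); case: (odd l); case: (odd s.+1).
  by rewrite !natrM; ring.
have [le_sk|lt_ks] := leqP s.+1 k.+1; last first.
  by rewrite big1 // => l _; rewrite /F ifF //; lia.
rewrite (@sum_ord_widen _ F _ (n + k).+1); first last.
- by move=> l ?; rewrite /F (@bin_small (n + k - l)); [rewrite !(muln0, mulr0) if_same|lia].
- lia.
rewrite -(@sum_ord_widen _ F (k - s).+1); first last.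
- by move=> l ?; rewrite /F; case: ifP => //; lia.
- lia.
transitivity ((-1) ^+ s.+1 * \sum_(l < (k - s).+1) ((-1) ^+ l *
     ('C(l + k.+1, k.+1) * 'C((k.+1 + k).+1, k - s - l) * 'C(n + k - l, k))%:R) : K).
  rewrite mulr_sumr; apply: eq_bigr => l _; rewrite /F ifT //.
  by have := ltn_ord l; lia.
rewrite saalschutz; last lia.
rewrite leq_subr subKn // subSS mulnC; congr (_ * ('C(_, _) * 'C(_, _))%:R); lia.
Qed.

(** * Identities for the Toeplitz entries, and Cramer's rule *)

Lemma toepC (K : comNzRingType) k a c : toep K k a c = toep K k c a.
Proof.
wlog le_ac : a c / (a <= c)%N => [H|].
  by case/orP: (leq_total a c) => /H.
rewrite /toep ifT; last lia.
case: leqP => lt_c; last by rewrite bin_small ?mulr0 //; lia.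
rewrite addnC -bin_sub; last lia.
by congr (_ * 'C(_, _)%:R); lia.
Qed.

Lemma toep_rev (K : comNzRingType) k n a c : (a <= n)%N -> (c <= n)%N ->
  toep K k (n - a) (n - c) = toep K k c a.
Proof.
move=> le_an le_cn; rewrite /toep.
have -> : (n - a <= k + (n - c))%N = (c <= k + a)%N by lia.
case: ifP => // le_ca; congr (_ * 'C(_, _)%:R); last lia.
rewrite -signr_odd -[RHS]signr_odd; congr (_ ^+ nat_of_bool _).
by rewrite !oddD !oddB //; case: (odd n); case: (odd a); case: (odd c).
Qed.

Lemma toepSS (K : comNzRingType) k a c : toep K k a.+1 c.+1 = toep K k a c.
Proof. by rewrite /toep !addnS subSS ltnS addSn !exprS !mulN1r opprK. Qed.

(** The left side is the monomial expansion of an inner product of two shifts of p_k. The constraint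
    fixes r = a + s - c; since C(k, r) = C(k, k-r), Vandermonde then sums over [s] to C(2k,
    k+c-a). *)
Lemma bin_toep (K : comNzRingType) (k a c : nat) :
  \sum_(r < k.+1) \sum_(s < k.+1)
     (-1) ^+ r * 'C(k, r)%:R * ((-1) ^+ s * 'C(k, s)%:R) * (a + s == c + r)%N%:R
  = toep K k a c.
Proof.
rewrite exchange_big /=.
pose F s : K := if (a <= k + c)%N && (s <= k + c - a)%N then
  (-1) ^+ (a + c) * ('C(k, s) * 'C(k, k + c - a - s))%:R else 0.
transitivity (\sum_(s < k.+1) F s).
  apply: eq_bigr => s _; have le_sk : (s <= k)%N by rewrite -ltnS.
  pose G r : K :=
    if (c <= a + s)%N then (-1) ^+ (a + c) * ('C(k, s) * 'C(k, r))%:R else 0.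
  rewrite (eq_bigr (fun r : 'I_k.+1 => if r == (a + s - c)%N :> nat then G r else 0)).
    rewrite -big_mkcond (big_ord1_eq _ G) /= /G /F.
    have [le_c|lt_c] := leqP c (a + s); last first.
      rewrite if_same; case: ifP => // /andP[? ?].
      by rewrite [X in (_ * X)%N]bin_small ?muln0 ?mulr0 //; lia.
    have -> : ((a <= k + c) && (s <= k + c - a))%N = (a + s - c < k.+1)%N by lia.
    case: ifP => // lt_k; rewrite -(@bin_sub k (a + s - c)) //.
    by congr (_ * (_ * 'C(_, _))%:R); lia.
  move=> r _; have [Er|neq] := eqVneq (a + s)%N (c + r)%N; last first.
    rewrite /= mulr0; case: ifP => // /eqP Er; rewrite /G; case: ifP => // le_c; lia.
  rewrite /G Er addKn eqxx leq_addr /= mulr1 natrM.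
  have -> : (-1) ^+ (a + c) = (-1) ^+ r * (-1) ^+ s :> K.
    rewrite -exprD -signr_odd -[RHS]signr_odd; congr (_ ^+ nat_of_bool _).
    have := congr1 odd Er; rewrite !oddD.
    by case: (odd a); case: (odd c); case: (odd r); case: (odd s).
  ring.
rewrite /toep; have [le_a|lt_a] := leqP; last first.
  by rewrite big1 // => s _; rewrite /F leqNgt lt_a.
rewrite (@sum_ord_widen _ F _ (k + (k + c - a)).+1); first last.
- by move=> s ?; rewrite /F (@bin_small k s); [rewrite mul0n mulr0 if_same|lia].
- lia.
rewrite -(@sum_ord_widen _ F (k + c - a).+1); first last.
- by move=> s ?; rewrite /F ifF //; lia.
- lia.
rewrite -addnn -binomial.Vandermonde natr_sum mulr_sumr; apply: eq_bigr => s _.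
by rewrite /F le_a -ltnS ltn_ord.
Qed.

(** Cramer's rule free of division: apply the adjugate to the hypothesis. *)
Lemma cofactor_solve (K : comNzRingType) n (A : 'M[K]_n) (v : 'cV_n) h r l :
  A *m v = h *: delta_mx r 0 -> h * cofactor A r l = \det A * v l 0.
Proof.
move=> Av; have := congr1 (fun B : 'M_n => (B *m v) l 0) (mul_adj_mx A).
rewrite /= -mulmxA Av mul_scalar_mx -scalemxAr !mxE => <-; congr (_ * _).
rewrite (bigD1 r) //= big1 ?addr0 => [|i /negPf ne_i]; first by rewrite !mxE !eqxx mulr1.
by rewrite !mxE ne_i mulr0.
Qed.

(** * Inner products, cofactors and the bases phi_n, psi_n *)

Section Hardy.
Variable R : realType.
Implicit Types p q : bipoly R.

Lemma hdotC p q : <(q, p)> = <(p, q)>^*.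
Proof.
rewrite (@hdot_bipoly _ q p (bdeg p)) ?geq_minr // (@hdot_bipoly _ p q (bdeg p)) ?geq_minl //.
rewrite rmorph_sum; apply: eq_bigr => a _; rewrite rmorph_sum; apply: eq_bigr => b _.
by rewrite rmorphM /= conjCK mulrC.
Qed.

Lemma hdot_suml n (c : 'I_n -> R[i]) (p : 'I_n -> bipoly R) q :
  <(\sum_i (c i)%:P%:P * p i, q)> = \sum_i c i * <(p i, q)>.
Proof.
rewrite (@hdot_bipoly _ _ q (bdeg q)) ?geq_minr //.
under [RHS]eq_bigr => i _.
  rewrite (@hdot_bipoly _ _ q (bdeg q)) ?geq_minr // mulr_sumr.
  under eq_bigr do rewrite mulr_sumr. over.
rewrite [RHS]exchange_big; apply: eq_bigr => a _; rewrite [RHS]exchange_big.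
apply: eq_bigr => b _; rewrite !coef_sum mulr_suml; apply: eq_bigr => i _.
by rewrite !coefCM mulrA.
Qed.

Lemma hdot_sumr n (c : 'I_n -> R[i]) (p : 'I_n -> bipoly R) q :
  <(q, \sum_i (c i)%:P%:P * p i)> = \sum_i (c i)^* * <(q, p i)>.
Proof.
rewrite hdotC hdot_suml rmorph_sum; apply: eq_bigr => i _.
by rewrite rmorphM [in RHS]hdotC.
Qed.

Lemma pk_monomialE k a b : pk R k * zvar R ^+ a * wvar R ^+ b =
  \sum_(r < k.+1) ((-1) ^+ r * 'C(k, r)%:R)%:P%:P *
     (zvar R ^+ (k - r + a) * wvar R ^+ (r + b)).
Proof.
rewrite /pk exprBn !mulr_suml; apply: eq_bigr => r _.
by rewrite !rmorphM !rmorphXn !rmorphN1 !rmorph_nat !exprD -mulr_natl; ring.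
Qed.

(** Equal total degrees make a match of the z-exponents force a match of the w-exponents, so the sum
    is that of [bin_toep]. *)
Lemma hdot_pk k a b c d : (a + b = c + d)%N ->
  <(pk R k * zvar R ^+ a * wvar R ^+ b, pk R k * zvar R ^+ c * wvar R ^+ d)>
  = toep R[i] k a c.
Proof.
move=> Eabcd; rewrite !pk_monomialE hdot_suml -bin_toep; apply: eq_bigr => r _.
rewrite hdot_sumr mulr_sumr; apply: eq_bigr => s _.
rewrite hdot_monomials rmorphM rmorphXn rmorphN1 rmorph_nat -!mulrA.
congr (_ * (_ * (_ * (_ * (nat_of_bool _)%:R)))).
by have := ltn_ord s; have := ltn_ord r; lia.
Qed.

Lemma gramAE k n i j : gramA R k n i j = toep R[i] k i j.
Proof. by rewrite mxE hdot_pk // !subnKC // -ltnS. Qed.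

Lemma cofactor_first k n (l : 'I_n.+1) : (0 < k)%N ->
  'C(n + k.*2, k)%:R * cofactor (gramA R k n) ord0 l =
  \det (gramA R k n) * (ucoef k n l)%:R.
Proof.
move=> k_gt0; pose v : 'cV[R[i]]_n.+1 := \col_i (ucoef k n i)%:R.
rewrite (@cofactor_solve _ _ _ v) ?mxE //; apply/colP => i; rewrite !mxE.
under eq_bigr do rewrite gramAE mxE mulrC toepC.
by rewrite toep_sum_low ?natrM ?andbT // -ltnS.
Qed.

Lemma cofactor_last k n (l : 'I_n.+1) : (0 < k)%N ->
  'C(n + k.*2, k)%:R * cofactor (gramA R k n) ord_max l =
  \det (gramA R k n) * (ucoef k n (n - l))%:R.
Proof.
move=> k_gt0; pose v : 'cV[R[i]]_n.+1 := \col_i (ucoef k n (n - i))%:R.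
rewrite (@cofactor_solve _ _ _ v) ?mxE //; apply/colP => i; rewrite !mxE.
have le_in : (i <= n)%N by rewrite -ltnS.
(* Reversing rows and columns transposes a Toeplitz matrix, which reduces the last row to the sum
   used for the first. *)
rewrite (reindex_inj rev_ord_inj) /=.
under eq_bigr => m _.
  have le_mn : (m <= n)%N by rewrite -ltnS.
  rewrite gramAE mxE /= subSS subKn // -{1}(subKn le_in) toep_rev ?leq_subr // mulrC; over.
rewrite toep_sum_low ?leq_subr // natrM andbT -val_eqE /=; congr (_ * _%:R); lia.
Qed.

(** The (0,0) minor of a Toeplitz matrix is the next smaller Toeplitz determinant, so this is
    [cofactor_first] at l = 0, where U_0 = C(n+k, k). *)
Lemma detD_rec k n : (0 < k)%N ->
  detD R k n.+1 * 'C(n + k, k)%:R = 'C(n + k.*2, k)%:R * detD R k n.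
Proof.
move=> k_gt0; have := cofactor_first (ord0 : 'I_n.+1) k_gt0.
rewrite /ucoef add0n binn mul1n subn0 => <-; congr (_ * _).
rewrite /cofactor expr0 mul1r; case: n => [|n]; first by rewrite det_mx00.
by congr (\det _); apply/matrixP => i j; rewrite [LHS]mxE [LHS]mxE !gramAE toepSS.
Qed.

(** Positivity follows from the recursion alone, without positive definiteness of the Gram
    matrix. *)
Lemma detD_gt0 k n : (0 < k)%N -> 0 < detD R k n.
Proof.
move=> k_gt0; elim: n => [|n IHn]; first exact: ltr01.
have b_gt0 : 0 < 'C(n + k, k)%:R :> R[i] by rewrite ltr0n bin_gt0 leq_addl.
by rewrite -(pmulr_lgt0 _ b_gt0) detD_rec // mulr_gt0 // ltr0n bin_gt0; lia.
Qed.

(** With h = C(n+2k, k) and b = C(n+k, k), the cofactor is (D_n/b) u_l and D_n D_(n+1) = (D_n/b)^2 h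
    b. As D_n/b > 0, it cancels against the square root. *)
Lemma cofrowE k n (r : 'I_n.+1) (u : nat -> nat) : (0 < k)%N ->
  (forall l : 'I_n.+1, 'C(n + k.*2, k)%:R * cofactor (gramA R k n) r l =
     \det (gramA R k n) * (u l)%:R) ->
  cofrow R k r = \sum_(l < n.+1) ((sqrtC ('C(n + k.*2, k) * 'C(n + k, k))%:R)^-1
     * (u l)%:R)%:P%:P * pmon R k n l.
Proof.
move=> k_gt0 Hu; rewrite /cofrow mulr_sumr; apply: eq_bigr => l _.
rewrite mulrA -!polyCM; congr (_%:P%:P * _).
have := detD_rec n k_gt0; have D0 := detD_gt0 n k_gt0; have := detD_gt0 n.+1 k_gt0.
have := Hu l; rewrite -[\det _]/(detD R k n.+1).
move: (cofactor _ _ _) (detD R k n.+1) (detD R k n) D0 => c D' D D0 Hc D'0.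
set h := 'C(n + k.*2, k) in Hc *; set b := 'C(_, k) in Hc *.
have h0 : 0 < h%:R :> R[i] by rewrite ltr0n bin_gt0; lia.
have b0 : 0 < b%:R :> R[i] by rewrite ltr0n bin_gt0; lia.
move=> ED'; have {ED'}D'E : D' = h%:R * D / b%:R by rewrite -ED' mulfK ?gt_eqF.
have cE : c = D / b%:R * (u l)%:R.
  apply: (mulfI (lt0r_neq0 h0)); rewrite Hc D'E; ring.
have -> : D * D' = (D / b%:R) ^+ 2 * (h * b)%:R.
  by rewrite D'E natrM; field; rewrite gt_eqF.
have Db0 : 0 < D / b%:R by rewrite divr_gt0.
rewrite sqrtCM ?nnegrE ?exprn_ge0 ?ler0n ?(ltW Db0) // sqrCK ?(ltW Db0) // cE.
by rewrite invfM mulrACA mulVf ?mul1r ?gt_eqF.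
Qed.

(** w^j z^l w^(n-l) and z^j z^m w^(n-m) have the same degree n + j, so [hdot_pk] applies with
    z-exponents [l] and m + j. The normalising constant is real, hence its product with its
    conjugate is a plain square. *)
Lemma alphaE k n j : (0 < k)%N ->
  alpha R k n j = ('C(n + k.*2, k) * 'C(n + k, k))%:R^-1 *
    \sum_(m < n.+1) (ucoef k n (n - m))%:R *
       \sum_(l < n.+1) (ucoef k n l)%:R * toep R[i] k l (m + j).
Proof.
move=> k_gt0; rewrite /alpha /phi /psi.
rewrite (cofrowE k_gt0 (fun l => cofactor_first l k_gt0)).
rewrite (cofrowE (u := fun l => ucoef k n (n - l)) k_gt0 (fun l => cofactor_last l k_gt0)).
set N := ('C(_, _) * _)%N; set c := _^-1.
have c2 : c * c^* = N%:R^-1.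
  have c_ge0 : 0 <= c by rewrite invr_ge0 sqrtC_ge0 ler0n.
  by rewrite (CrealP (ger0_real c_ge0)) -expr2 exprVn sqrtCK.
rewrite !mulr_sumr.
under eq_bigr do rewrite mulrCA.
under [X in <(_, X)>]eq_bigr do rewrite mulrCA.
rewrite hdot_sumr; apply: eq_bigr => m _; rewrite hdot_suml -c2 !mulr_sumr.
apply: eq_bigr => l _; rewrite rmorphM rmorph_nat.
have le_mn : (m <= n)%N by rewrite -ltnS.
have le_ln : (l <= n)%N by rewrite -ltnS.
have -> : wvar R ^+ j * pmon R k n l = pk R k * zvar R ^+ l * wvar R ^+ (n - l + j).
  by rewrite /pmon exprD; ring.
have -> : zvar R ^+ j * pmon R k n m = pk R k * zvar R ^+ (m + j) * wvar R ^+ (n - m).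
  by rewrite /pmon exprD; ring.
rewrite hdot_pk; [ring|lia].
Qed.

End Hardy.

(** * Rising factorials and integer binomials of the stated formula *)

Lemma rising_fact (K : comNzRingType) m s :
  rising m.+1%:R s * m`!%:R = (m + s)`!%:R :> K.
Proof.
elim: s => [|s IHs]; first by rewrite /rising big_ord0 mul1r addn0.
rewrite /rising big_ord_recr /= -/(rising _ s) mulrAC IHs addnS factS mulnC natrM.
by rewrite -natrD addSn.
Qed.

(** Turns the binomials in E(n+s) into the quotient of rising factorials of the statement, with [k]
    and [s] both lowered by one. *)
Lemma bin_rising (K : numDomainType) k n s : (s <= k)%N ->
  ('C(n + k.+1.*2, k - s) * 'C(n + s, s))%:R * rising (n + k.+1 + 1)%:R s.+1
  = ('C(n + k.+1.*2, k.+1) * (k.+1 * 'C(k, s)))%:R * rising n.+1%:R s :> K.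
Proof.
move=> le_sk; have f0 : ((n + k.+1)`! * n`!)%:R != 0 :> K.
  by rewrite pnatr_eq0 -lt0n muln_gt0 !fact_gt0.
apply: (mulIf f0); set X := ('C(_, k - s) * _)%N; set Y := (_ * (k.+1 * _))%N.
transitivity ((X * (n + k.+1 + s.+1)`! * n`!)%:R : K).
  by rewrite !natrM -(rising_fact _ (n + k.+1)) addn1; ring.
transitivity ((Y * (n + s)`! * (n + k.+1)`!)%:R : K); last first.
  by rewrite !natrM -(rising_fact _ n); ring.
rewrite /X /Y; congr _%:R.
(* Once multiplied by s! (k-s)!, both sides equal (n+2(k+1))! (n+s)!. *)
apply/eqP; rewrite -(eqn_pmul2r (fact_gt0 s)) -(eqn_pmul2r (fact_gt0 (k - s))); apply/eqP.
have e1 : (k - s <= n + k.+1.*2)%N by lia.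
have e2 : (k.+1 <= n + k.+1.*2)%N by lia.
transitivity ((n + k.+1.*2)`! * (n + s)`!)%N.
  rewrite -(bin_fact e1) -(bin_fact (leq_addl n s)) addnK.
  have -> : (n + k.+1.*2 - (k - s) = n + k.+1 + s.+1)%N by lia.
  by ring.
rewrite -(bin_fact e2) factS -(bin_fact le_sk).
have -> : (n + k.+1.*2 - k.+1 = n + k.+1)%N by lia.
by ring.
Qed.

Lemma binzE (a b : nat) : binz a b = 'C(a, b).
Proof. by rewrite /binz /= lez_nat; case: leqP => // /bin_small. Qed.

(** The zero convention truncates U_(j-s) to its natural range: the second binomial vanishes for j <
    s, the first for j > n + s. *)
Lemma binz_ucoef k n j s : (0 < k)%N ->
  (binz (n%:Z - j%:Z + s%:Z + k%:Z) k%:Z * binz (j%:Z - s%:Z + k%:Z - 1) (k%:Z - 1))%N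
  = if (s <= j <= n + s)%N then ucoef k n (j - s) else 0%N.
Proof.
case: k => // k _.
have -> : k.+1%:Z - 1 = k by lia.
have [le_sj|lt_js] := leqP s j; last first.
  by rewrite [X in (_ * X)%N]/binz ifF ?muln0 //; lia.
have [le_j|lt_j] := leqP j (n + s); last first.
  by rewrite [X in (X * _)%N]/binz ifF //; lia.
have -> : n%:Z - j%:Z + s%:Z + k.+1%:Z = (n - (j - s) + k.+1)%N by lia.
have -> : j%:Z - s%:Z + k.+1%:Z - 1 = (j - s + k)%N by lia.
by rewrite !binzE mulnC.
Qed.

Lemma alpha_term0 (R : realType) k n j s : (0 < k)%N ->
  ~~ (s <= j <= n + s)%N -> alpha_term R k n j s = 0.
Proof.
move=> k_gt0 /negPf sF; have := binz_ucoef n j s k_gt0.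
rewrite sF => /(congr1 (fun m => m%:R : R[i])); rewrite natrM => b0.
by rewrite /alpha_term -[_ * _ * (binz (j%:Z - _ + _ - _) _)%:R]mulrA b0 mulr0.
Qed.

Lemma alpha_termE (R : realType) k n j s : (0 < k)%N -> (0 < s <= k)%N ->
  'C(n + k.*2, k)%:R * alpha_term R k n j s =
  (-1) ^+ s * ('C(n + k.*2, k - s) * 'C((n + s).-1, s.-1))%:R *
  (if (s <= j <= n + s)%N then ucoef k n (j - s) else 0%N)%:R.
Proof.
move=> k_gt0 /andP[]; rewrite -(binz_ucoef n j s k_gt0) /alpha_term.
case: k s k_gt0 => // k [] // s _ _ le_sk.
have -> : k.+1%:Z - 1 = k by lia.
have -> : s.+1%:Z - 1 = s by lia.
rewrite binzE !subn1 subSS (addnS n s) !succnK.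
have r_neq0 : rising (n + k.+1 + 1)%:R s.+1 != 0 :> R[i].
  apply/eqP => r0; have := @rising_fact R[i] (n + k.+1) s.+1.
  by rewrite -addn1 r0 mul0r => /esym/eqP; rewrite pnatr_eq0 eqn0Ngt fact_gt0.
have -> : ('C(n + k.+1.*2, k - s) * 'C(n + s, s))%:R =
    ('C(n + k.+1.*2, k.+1) * (k.+1 * 'C(k, s)))%:R * rising n.+1%:R s
      / rising (n + k.+1 + 1)%:R s.+1 :> R[i].
  by rewrite -bin_rising // mulfK.
rewrite !natrM; ring.
Qed.

Theorem lemma4p1 (R : realType) (k : nat) (hk : (1 <= k)%N)
    (n j : nat) (hj : (1 <= j)%N) :
  alpha R k n j =
    (binz (n%:Z + k%:Z) k%:Z)%:R^-1 *
      \sum_(1 <= s < k.+1) alpha_term R k n j s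
  /\ alpha R k n j =
    (binz (n%:Z + k%:Z) k%:Z)%:R^-1 *
      \sum_(1 <= s < k.+1 | (Num.max 1 (j%:Z - n%:Z) <= s%:Z <= Num.min k%:Z j%:Z))
         alpha_term R k n j s
  /\ (forall s : nat, (1 <= s <= k)%N ->
        ~~ (Num.max 1 (j%:Z - n%:Z) <= s%:Z <= Num.min k%:Z j%:Z) ->
        alpha_term R k n j s = 0).
Proof.
have vanish s : (1 <= s <= k)%N ->
    ~~ (Num.max 1 (j%:Z - n%:Z) <= s%:Z <= Num.min k%:Z j%:Z) -> alpha_term R k n j s = 0.
  move=> s_in s_out; apply: alpha_term0 => //; move: s_out.
  by rewrite ge_max le_min; lia.
have main : alpha R k n j =
    (binz (n%:Z + k%:Z) k%:Z)%:R^-1 * \sum_(1 <= s < k.+1) alpha_term R k n j s.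
  rewrite alphaE // -PoszD binzE natrM invfM -mulrA mulrCA; congr (_ * _).
  have h_neq0 : 'C(n + k.*2, k)%:R != 0 :> R[i] by rewrite pnatr_eq0 -lt0n bin_gt0; lia.
  apply: (mulfI h_neq0); rewrite mulVKf // mulr_sumr.
  pose E s : R[i] := (-1) ^+ s * ('C(n + k.*2, k - s) * 'C((n + s).-1, s.-1))%:R.
  pose G s m : R[i] := (ucoef k n (n - m))%:R * E s.
  (* Each E(m+j) is written as a sum over [s] with at most one nonzero term, so that the two
     summations can be exchanged. *)
  transitivity (\sum_(m < n.+1) \sum_(1 <= s < k.+1) if (m + j == n + s)%N then G s m else 0).
    apply: eq_bigr => m _; have le_mn : (m <= n)%N by rewrite -ltnS.
    rewrite -big_mkcond; have [le_mj|lt_mj] := leqP (m + j) n.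
      (* Here j >= 1 matters: it excludes m + j = 0, the only index up to [n] at which E is
         nonzero. *)
      rewrite toep_sum_low // (_ : (m + j == 0)%N = false) ?muln0 ?mulr0; last lia.
      by rewrite big_nat_cond big1 // => s; lia.
    pose s0 := (m + j - n)%N; have s0_gt0 : (0 < s0)%N by rewrite subn_gt0.
    have -> : (m + j = n + s0)%N by rewrite subnKC // ltnW.
    rewrite toep_sum_high //; under eq_bigl do rewrite eqn_add2l eq_sym.
    have [le_s0|lt_s0] := leqP s0 k; last first.
      by rewrite mulr0 big_nat_cond big1 // => s /andP[? /eqP ?]; lia.
    by rewrite (big_nat1_eq _ (fun s => G s m)) ifT //; lia.
  rewrite exchange_big; apply: eq_big_nat => s s_in.
  rewrite alpha_termE // -/(E s); have [/andP[le_sj le_j]|out] := ifPn.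
    (* For fixed [s] only m = n + s - j survives, and then n - m = j - s. *)
    rewrite (eq_bigr (fun m : 'I_n.+1 => if m == (n + s - j)%N :> nat then G s m else 0)).
      rewrite -big_mkcond (big_ord1_eq _ (G s)) ifT; last lia.
      by rewrite /G mulrC; congr (_ * (ucoef _ _ _)%:R); lia.
    by move=> m _; congr (if _ then _ else _); lia.
  by rewrite mulr0 big1 // => m _; rewrite ifF //; have := ltn_ord m; lia.
split=> //; split=> //; rewrite main; congr (_ * _).
rewrite [RHS]big_mkcond; apply: eq_big_nat => s s_in.
by case: ifPn => // /vanish ->.
Qed.
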